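(* Let $\mu$ be a probability measure on $\mathbb{R}$ whose support is not included in $(-\infty,0)$, and let $\mu^{*n}$ denote its $n$-fold convolution power. Consider the condition (E) there exists $\alpha>0$ such that $\mu^{*n}((-\infty,0))\le e^{-\alpha n}$ for infinitely many $n\ge1$. Whether (E) holds is determined by the restrictions of the measures $\mu^{*n}$, $n\ge1$, to $[0,\infty)$. Moreover, if (E) holds, then $\mu\in\mathscr{C}$, i.e. every probability measure $\mu_1$ on $\mathbb{R}$ such that $\mu_1^{*n}$ and $\mu^{*n}$ coincide on the Borel subsets of $[0,\infty)$ for all $n\ge1$ satisfies $\mu_1=\mu$.
   Context: $\mathscr{C}$ denotes the set of probability measures $\mu$ on $\mathbb{R}$ with the property: if $\mu_1$ is a probability measure on $\mathbb{R}$ with $\mu_1^{*n}=\mu^{*n}$ on $[0,\infty)$ for all $n\ge 1$, then $\mu_1=\mu$. Note $\mu^{*n}((-\infty,0))=\mathbb{P}(S_n<0)$ where $(S_n)$ is a random walk with $S_0=0$ and step distribution $\mu$. *)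

(* Defs.v *)
From HB Require Import structures.
From mathcomp Require Import all_boot all_order all_algebra.
From mathcomp Require Import all_classical all_reals all_analysis.
Set Implicit Arguments. Unset Strict Implicit. Unset Printing Implicit Defensive.
Import Order.TTheory GRing.Theory Num.Theory.
Import numFieldNormedType.Exports.
Local Open Scope classical_set_scope.
Local Open Scope ring_scope.

Definition conv (R : realType) (mu : {measure set R -> \bar R})
  (nu : set R -> \bar R) : set R -> \bar R :=
  fun A => (\int[mu]_x nu [set y : R | A (x + y)%R])%E.

Fixpoint conv_pow (R : realType) (mu : {measure set R -> \bar R}) (n : nat)
  : set R -> \bar R :=
  match n with
  | 0%N => fun A => \d_(0 : R) A
  | n'.+1 => conv mu (conv_pow mu n')
  end.

Definition msupport (R : realType) (mu : {measure set R -> \bar R}) : set R :=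
  [set x : R | forall e : R, 0 < e -> (0 < mu [set` `](x - e)%R, (x + e)%R[])%E].

Definition condE (R : realType) (mu : {measure set R -> \bar R}) : Prop :=
  exists alpha : R, 0 < alpha /\
    forall N : nat, exists n : nat, (N <= n)%N /\ (1 <= n)%N /\
      (conv_pow mu n [set` `]-oo, (0%R : R)[] <= (expR (- (alpha * n%:R)))%:E)%E.

Definition same_pos_restrictions (R : realType)
  (mu1 mu : {measure set R -> \bar R}) : Prop :=
  forall n : nat, (1 <= n)%N ->
    forall A : set R, measurable A -> A `<=` [set` `[(0:R), +oo[] ->
      conv_pow mu1 n A = conv_pow mu n A.

Definition classC (R : realType) (mu : probability R R) : Prop :=
  forall mu1 : probability R R, same_pos_restrictions mu1 mu ->
    forall A : set R, measurable A -> mu1 A = mu A.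

(* Main.v *)
Require Import Defs.
From HB Require Import structures.
From mathcomp Require Import all_boot all_order all_algebra.
From mathcomp Require Import all_classical all_reals all_analysis.
From mathcomp Require Import measurable_realfun.
From mathcomp Require Import ring lra.
Set Implicit Arguments.
Unset Strict Implicit.
Unset Printing Implicit Defensive.

Import Order.TTheory GRing.Theory Num.Theory.
Import numFieldNormedType.Exports.
Local Open Scope classical_set_scope.
Local Open Scope ring_scope.

(* Write S_n for the random walk with step law mu. Since P(S_n < 0) is
   1 - mu^{*n}([0, +oo[), condition (E) only depends on the restrictions.

   The sequence P(S_n < 0) is supermultiplicative, so (E) improves to
   P(S_n < 0) <= q^n for all n >= 1 and some q < 1. A first step below -cn
   followed by n steps that are at most c makes the walk negative, so
   mu(]-oo, -cn[) P(X <= c)^n <= q^(n+1), and mu has an exponential left tail.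
   Hence phi(t) = E e^(-tX) is finite for small t >= 0, and for t small enough
   E[e^(-t S_n); S_n < 0] <= 2 r^n with r < 1. If mu1 has the same restrictions,
   then (E) holds for mu1, and phi(t)^n - phi1(t)^n = O(r^n) because the parts
   of both powers carried by [0, +oo[ agree; as phi(t) -> 1 when t -> 0, this
   forces phi = phi1 near 0.

   It remains to recover the restriction of mu to ]-oo, 0[ from its Laplace
   transform on an interval. The functions with equal (weighted) integrals form
   a vector space closed under bounded pointwise limits: difference quotients
   and Taylor expansions propagate from e^(sx), 0 < s < b, to all s > 0, and
   (1 - e^(nx))^m with m of order n e^(na) converges to the indicator of
   ]-oo, -a[. *)

(** * The one-step averaging operator of the random walk *)

(** This is [E f(y + X)] as a function of the starting point [y], so that the [n]-th iterate at [0]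
    is [E f(S_n)]. Working with functions allows inductions on [n] that move the starting point,
    while [conv_pow] is only a bare set function. *)
Definition walk_op (R : realType) (mu : probability R R) (f : R -> \bar R)
  : R -> \bar R := fun y => (\int[mu]_x f (y + x)%R)%E.

Section walk_operator.
Context {R : realType} (mu : probability R R).
Local Open Scope ereal_scope.
Implicit Types f g : R -> \bar R.

Local Notation T := (walk_op mu).

Let measurable_shift f (y : R) : measurable_fun setT f ->
  measurable_fun setT (fun x => f (y + x)%R).
Proof.
by move=> mf; apply: measurableT_comp => //; exact: measurable_funD.
Qed.

Lemma walk_op_ge0 f : (forall x, 0 <= f x) -> forall y, 0 <= T f y.
Proof. by move=> f0 y; apply: integral_ge0. Qed.

Lemma measurable_walk_op f : (forall x, 0 <= f x) -> measurable_fun setT f ->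
  measurable_fun setT (T f).
Proof.
move=> f0 mf; pose h (p : R * R) := f (p.1 + p.2)%R.
apply: (measurable_fun_fubini_tonelli_F (m2 := mu) h) => [|p].
  by apply: measurableT_comp => //; exact: measurable_funD.
exact: f0.
Qed.

Lemma iter_walk_op_ge0 n f : (forall x, 0 <= f x) ->
  forall y, 0 <= iter n T f y.
Proof. by move=> f0; elim: n => [//|n ih] y /=; exact: walk_op_ge0. Qed.

Lemma measurable_iter_walk_op n f : (forall x, 0 <= f x) ->
  measurable_fun setT f -> measurable_fun setT (iter n T f).
Proof.
move=> f0 mf; elim: n => [//|n ih] /=.
by apply: measurable_walk_op => //; exact: iter_walk_op_ge0.
Qed.

Lemma le_walk_op f g : (forall x, 0 <= f x) -> measurable_fun setT f ->
  measurable_fun setT g -> (forall x, f x <= g x) -> forall y, T f y <= T g y.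
Proof.
by move=> f0 mf mg fg y; apply: ge0_le_integral => //; exact: measurable_shift.
Qed.

Lemma le_iter_walk_op n f g : (forall x, 0 <= f x) -> measurable_fun setT f ->
  measurable_fun setT g -> (forall x, f x <= g x) ->
  forall y, iter n T f y <= iter n T g y.
Proof.
move=> f0 mf mg fg; elim: n => [//|n ih] /=.
have g0 x : 0 <= g x by exact: le_trans (fg x).
by apply: le_walk_op => //; [exact: iter_walk_op_ge0|
  exact: measurable_iter_walk_op|exact: measurable_iter_walk_op].
Qed.

Lemma iter_walk_opD n f g : (forall x, 0 <= f x) -> measurable_fun setT f ->
  (forall x, 0 <= g x) -> measurable_fun setT g ->
  iter n T (fun x => f x + g x) = (fun y => iter n T f y + iter n T g y).
Proof.
move=> f0 mf g0 mg; elim: n => [//|n ih] /=; rewrite ih.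
apply/funext => y; rewrite /walk_op ge0_integralD//.
- by move=> x _; exact: iter_walk_op_ge0.
- by apply: measurable_shift; exact: measurable_iter_walk_op.
- by move=> x _; exact: iter_walk_op_ge0.
- by apply: measurable_shift; exact: measurable_iter_walk_op.
Qed.

Lemma iter_walk_opZ n (k : R) f : (0 <= k)%R -> (forall x, 0 <= f x) ->
  measurable_fun setT f ->
  iter n T (fun x => k%:E * f x) = (fun y => k%:E * iter n T f y).
Proof.
move=> k0 f0 mf; elim: n => [//|n ih] /=; rewrite ih.
apply/funext => y; rewrite /walk_op ge0_integralZl_EFin//.
- by move=> x _; exact: iter_walk_op_ge0.
- by apply: measurable_shift; exact: measurable_iter_walk_op.
Qed.

Lemma iter_walk_op_sum n (I : Type) (s : seq I) (F : I -> R -> \bar R) :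
  (forall i x, 0 <= F i x) -> (forall i, measurable_fun setT (F i)) ->
  iter n T (fun x => \sum_(i <- s) F i x) =
  (fun y => \sum_(i <- s) iter n T (F i) y).
Proof.
move=> F0 mF; elim: n => [//|n ih] /=; rewrite ih.
apply/funext => y; rewrite /walk_op ge0_integral_sum//.
- by move=> i; apply: measurable_shift; exact: measurable_iter_walk_op.
- by move=> i x _; exact: iter_walk_op_ge0.
Qed.

Lemma iter_walk_op_cst n (k : R) : iter n T (cst k%:E) = cst k%:E.
Proof.
elim: n => [//|n ih] /=; rewrite ih; apply/funext => y.
by rewrite /walk_op integral_cst//= probability_setT mule1.
Qed.

(** The translate by [y] is what makes the induction close: after a first step [x] the walk starts
    from [y + x]. *)
Lemma conv_pow_walk_op n (A : set R) (y : R) :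
  conv_pow mu n [set z | A (y + z)%R] = iter n T (EFin \o \1_A) y.
Proof.
elim: n y => [|n ih] y /=.
  rewrite diracE indicE; congr (nat_of_bool _)%:R%:E.
  by apply/idP/idP; rewrite !in_setE /= addr0.
rewrite /conv /walk_op; apply: eq_integral => x _.
rewrite -ih; congr conv_pow; apply/seteqP.
by split => z /=; rewrite addrA.
Qed.

End walk_operator.

(** * Geometric bounds for supermultiplicative sequences *)

(** Bernoulli's inequality combined with the archimedean property. *)
Lemma expr_unbounded (R : realType) (w c : R) : 1 < w ->
  exists k0 : nat, forall k, (k0 <= k)%N -> c < w ^+ k.
Proof.
move=> w1; have bern k : 1 + k%:R * (w - 1) <= w ^+ k.
  elim: k => [|k ih]; first by rewrite mul0r addr0 expr0.
  rewrite exprS -natr1.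
  have k0 : 0 <= k%:R * (w - 1) ^+ 2 by rewrite mulr_ge0// sqr_ge0.
  have : w * (1 + k%:R * (w - 1)) <= w * w ^+ k by rewrite ler_pM2l//; lra.
  by apply: le_trans; rewrite -subr_ge0 (_ : _ - _ = k%:R * (w - 1) ^+ 2)//; ring.
have w10 : 0 < w - 1 by rewrite subr_gt0.
exists (Num.bound `|c / (w - 1)|) => k hk.
have h : `|c / (w - 1)| < k%:R.
  by rewrite (lt_le_trans (archi_boundP (normr_ge0 _)))// ler_nat.
apply: lt_le_trans (bern k).
have : c / (w - 1) < k%:R by apply: le_lt_trans h; exact: ler_norm.
by rewrite ltr_pdivrMr// => h'; rewrite (lt_trans h')// ltrDr.
Qed.

(** A Fekete-type argument. If [u m > q ^+ m] for one [m], then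
    [u (m * k + r) >= u m ^+ k * u 1 ^+ r] beats [q ^+ (m * k + r)] for all large [k], uniformly in
    [r < m], which contradicts the bound along infinitely many indices. *)
Lemma supermultiplicative_le_geometric (R : realType) (u : nat -> R) (q : R) :
  0 < q <= 1 -> (forall n, 0 <= u n) -> 0 < u 1%N <= 1 ->
  (forall m n, u m * u n <= u (m + n)%N) ->
  (forall N : nat, exists n, (N <= n)%N /\ u n <= q ^+ n) ->
  forall m, (0 < m)%N -> u m <= q ^+ m.
Proof.
move=> /andP[q0 q1] u0 /andP[u1 u1le] uM hu m m0.
rewrite leNgt; apply/negP => qum.
have uexp k : (0 < k)%N -> u m ^+ k <= u (m * k)%N.
  elim: k => [//|[_ _|k ih _]]; first by rewrite expr1 muln1.
  rewrite exprS mulnS; apply: le_trans (uM _ _).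
  by rewrite ler_wpM2l// ih.
have uexpD k r : (0 < k)%N -> u m ^+ k * u 1%N ^+ r <= u (m * k + r)%N.
  move=> k0; elim: r => [|r ih]; first by rewrite expr0 mulr1 addn0 uexp.
  rewrite exprSr mulrA addnS -(addn1 (m * k + r)); apply: (le_trans _ (uM _ _)).
  by rewrite ler_wpM2r.
have qm0 : 0 < q ^+ m by rewrite exprn_gt0.
have w1 : 1 < u m / q ^+ m by rewrite ltr_pdivlMr// mul1r.
(* The threshold [u 1 ^- m] pays for the remainder of the division by [m]: since [r < m] and
   [u 1 <= 1], [u 1 ^+ m <= u 1 ^+ r]. *)
have [k0 hk0] := expr_unbounded (u 1%N ^- m) w1.
have [n [hn un]] := hu (m * k0.+1)%N.
pose k := (n %/ m)%N; pose r := (n %% m)%N.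
have nE : n = (m * k + r)%N by rewrite /k /r mulnC -divn_eq.
have kk : (k0 < k)%N by rewrite /k leq_divRL// mulnC.
have rm : (r < m)%N by rewrite ltn_mod.
have kpos : (0 < k)%N by exact: leq_ltn_trans kk.
have /= := hk0 k (ltnW kk); rewrite ltNge => /negP; apply.
have um1 : 0 < u 1%N ^+ m by rewrite exprn_gt0.
rewrite -[leRHS]div1r ler_pdivlMr// expr_div_n mulrAC ler_pdivrMr ?exprn_gt0//.
rewrite mul1r -exprM; apply: (@le_trans _ _ (u m ^+ k * u 1%N ^+ r)).
  rewrite ler_wpM2l ?exprn_ge0//.
  by rewrite -(subnKC (ltnW rm)) exprD ler_piMr ?exprn_ge0// exprn_ile1.
apply: le_trans (uexpD _ _ kpos) _; rewrite -nE (le_trans un)//.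
by rewrite {1}nE exprD ler_piMr ?exprn_ge0 ?exprn_ile1// ltW.
Qed.

(** * The probability that the walk is negative *)

Section negative_half_line.
Context {R : realType} (mu : probability R R).
Local Open Scope ereal_scope.

Local Notation T := (walk_op mu).
Local Notation neg := (`]-oo, 0%R[%classic : set R).

Lemma conv_powE n (A : set R) : conv_pow mu n A = iter n T (EFin \o \1_A) 0%R.
Proof.
rewrite -conv_pow_walk_op; congr conv_pow.
by apply/seteqP; split => z /=; rewrite add0r.
Qed.

Lemma measurable_indicE (A : set R) : measurable A ->
  measurable_fun setT (EFin \o \1_A : R -> \bar R).
Proof. by move=> mA; apply/measurable_EFinP; exact: measurable_indic. Qed.

Lemma indicE_ge0 (A : set R) (x : R) : 0 <= (EFin \o \1_A) x :> \bar R.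
Proof. by rewrite /= lee_fin indicE. Qed.

Lemma conv_pow_ge0 n (A : set R) : 0 <= conv_pow mu n A.
Proof. by rewrite conv_powE iter_walk_op_ge0//; exact: indicE_ge0. Qed.

(** Additivity comes from linearity of the iterated operator, applied to the indicators of [A] and
    its complement, whose sum is the constant [1]. *)
Lemma conv_pow_setC n (A : set R) : measurable A ->
  conv_pow mu n A + conv_pow mu n (~` A) = 1.
Proof.
move=> mA; rewrite !conv_powE.
have -> : iter n T (EFin \o \1_A) 0%R + iter n T (EFin \o \1_(~` A)) 0%R =
  iter n T (cst 1%:E) 0%R.
  rewrite (_ : cst 1%:E =
    (fun x : R => (EFin \o \1_A) x + (EFin \o \1_(~` A)) x)).
    rewrite iter_walk_opD//; do ?[exact: indicE_ge0|exact: measurable_indicE].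
    by apply: measurable_indicE; exact: measurableC.
  apply/funext => x /=; rewrite !indicE in_setC -EFinD.
  by case: (x \in A); rewrite /= ?addr0 ?add0r.
by rewrite iter_walk_op_cst.
Qed.

Lemma conv_pow_le1 n (A : set R) : measurable A -> conv_pow mu n A <= 1.
Proof.
by move=> mA; rewrite -(conv_pow_setC n mA) leeDl// conv_pow_ge0.
Qed.

Lemma conv_pow_fin_num n (A : set R) : measurable A ->
  conv_pow mu n A \is a fin_num.
Proof.
move=> mA; rewrite ge0_fin_numE ?conv_pow_ge0//.
by rewrite (le_lt_trans (conv_pow_le1 n mA))// ltry.
Qed.

Lemma conv_pow1 (A : set R) : measurable A -> conv_pow mu 1 A = mu A.
Proof.
move=> mA; rewrite conv_powE /= /walk_op.
under eq_integral do rewrite add0r.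
by rewrite /comp integral_indic// setIT.
Qed.

Lemma iter_walk_op_anti n (f : R -> \bar R) : (forall x, 0 <= f x) ->
  measurable_fun setT f -> (forall x y, (x <= y)%R -> f y <= f x) ->
  forall x y, (x <= y)%R -> iter n T f y <= iter n T f x.
Proof.
move=> f0 mf fxy; elim: n => [//|n ih] x y xy /=; rewrite /walk_op.
apply: ge0_le_integral => //.
- by move=> z _; exact: iter_walk_op_ge0.
- apply: measurableT_comp; last exact: measurable_funD.
  exact: measurable_iter_walk_op.
- apply: measurableT_comp; last exact: measurable_funD.
  exact: measurable_iter_walk_op.
- by move=> z _; rewrite ih// lerD2r.
Qed.

Lemma indic_lt_anti (b x y : R) : (x <= y)%R ->
  (EFin \o \1_(`]-oo, b[%classic : set R)) y <=
  (EFin \o \1_(`]-oo, b[%classic : set R)) x :> \bar R.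
Proof.
move=> xy; rewrite /= lee_fin !indicE ler_nat.
case: (boolP (y \in _)) => //; rewrite inE /= in_itv /= => yb.
by rewrite mem_set//= in_itv /= (le_lt_trans xy).
Qed.

(** If the walk is negative after [m] steps, the next [n] steps start from some [x < 0], where they
    end below [0] with probability at least [P(S_n < 0)]. In terms of functions, with
    [k = P(S_n < 0)], [k] times the indicator of [neg] is below the [n]-th iterate of that
    indicator. *)
Lemma conv_pow_neg_supermul m n :
  conv_pow mu m neg * conv_pow mu n neg <= conv_pow mu (m + n) neg.
Proof.
have mneg : measurable neg by [].
rewrite -(fineK (conv_pow_fin_num n mneg)); set k := fine _.
have k0 : (0 <= k)%R by rewrite fine_ge0// conv_pow_ge0.
rewrite !conv_powE iterD muleC.
have fg0 := @indicE_ge0 neg.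
have mfg := measurable_indicE mneg.
have := congr1 (@^~ 0%R) (iter_walk_opZ mu m k0 fg0 mfg); rewrite /= => <-.
apply: le_iter_walk_op.
- by move=> x; rewrite mule_ge0.
- exact: measurable_funeM.
- exact: measurable_iter_walk_op.
- move=> x; rewrite /= indicE; case: (boolP (x \in neg)) => [|_].
    rewrite inE /= in_itv /= => x0; rewrite mule1.
    rewrite /k fineK ?conv_pow_fin_num// conv_powE.
    by apply: iter_walk_op_anti; [|exact: mfg|exact: indic_lt_anti|exact: ltW].
  by rewrite mule0 iter_walk_op_ge0.
Qed.

(** Supermultiplicativity turns infinitely many [n] into all [n >= 1], with [q = e^(-alpha)];
    [0 < mu neg] provides the positive first term. *)
Lemma condE_all : condE mu -> 0 < mu neg -> exists q : R, (0 < q < 1)%R /\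
  forall n, (1 <= n)%N -> conv_pow mu n neg <= (q ^+ n)%:E.
Proof.
move=> [a [a0 ha]] mu0; have mneg : measurable neg by [].
exists (expR (- a)); split; first by rewrite expR_gt0 expR_lt1 oppr_lt0.
have conv1 := conv_pow1 mneg.
pose u n := fine (conv_pow mu n neg).
have uE n : (u n)%:E = conv_pow mu n neg by rewrite fineK ?conv_pow_fin_num.
move=> n n1; rewrite -uE lee_fin.
apply: supermultiplicative_le_geometric => //.
- by rewrite expR_gt0/= ltW// expR_lt1 oppr_lt0.
- by move=> m; rewrite -lee_fin uE conv_pow_ge0.
- by rewrite -lte_fin -lee_fin uE conv_pow_le1// andbT conv1.
- by move=> m k; rewrite -lee_fin EFinM !uE conv_pow_neg_supermul.
- move=> N; have [k [Nk [k1 hk]]] := ha N; exists k; split => //.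
  by rewrite -lee_fin uE (le_trans hk)// lee_fin -expRM_natl mulrN mulrC.
Qed.

End negative_half_line.

(** * Condition (E) is read off the restrictions to the half-line [[0, +oo[] *)

Lemma same_pos_conv_pow_neg (R : realType) (mu1 mu : probability R R) n :
  same_pos_restrictions mu1 mu -> (1 <= n)%N ->
  conv_pow mu1 n `]-oo, 0[%classic = conv_pow mu n `]-oo, 0[%classic.
Proof.
move=> same n1.
have mneg : measurable (`]-oo, 0[%classic : set R) by [].
have CE : ~` `]-oo, 0[%classic = `[0, +oo[%classic :> set R.
  by rewrite setCitvl.
have := conv_pow_setC mu1 n mneg; rewrite -(conv_pow_setC mu n mneg).
rewrite CE (same n n1 `[0, +oo[%classic)//.
have fin : conv_pow mu n (`[0, +oo[%classic : set R) \is a fin_num.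
  by rewrite conv_pow_fin_num.
by move=> h; rewrite -[LHS](addeK _ fin) h addeK.
Qed.

Lemma same_pos_condE (R : realType) (mu1 mu : probability R R) :
  same_pos_restrictions mu1 mu -> condE mu1 <-> condE mu.
Proof.
move=> same; split=> -[a [a0 h]]; exists a; split=> // N;
  have [n [Nn [n1 hn]]] := h N; exists n; do 2 split => //.
- by rewrite -(same_pos_conv_pow_neg same).
- by rewrite (same_pos_conv_pow_neg same).
Qed.

(** * The exponential left tail of the step law *)

Lemma exists_natr_itv (R : realType) (v : R) : 0 < v ->
  exists n : nat, n%:R < v <= n.+1%:R.
Proof.
move=> v0; have hex : exists n : nat, v <= n.+1%:R.
  exists (Num.bound v); apply: ltW; apply: lt_le_trans (archi_boundP (ltW v0)) _.
  by rewrite ler_nat.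
case: (ex_minnP hex) => -[|n] vn nmin; first by exists 0%N; rewrite v0.
exists n.+1; rewrite vn andbT ltNge; apply/negP => /nmin.
by rewrite ltnn.
Qed.

(** With this sign, [t > 0] probes the left tail; the value may be [+oo]. *)
Definition laplace (R : realType) (mu : probability R R) (t : R) : \bar R :=
  (\int[mu]_x (expR (- (t * x)))%:E)%E.

Section exponential_tail.
Context {R : realType} (mu : probability R R).
Local Open Scope ereal_scope.

Local Notation T := (walk_op mu).
Local Notation neg := (`]-oo, 0%R[%classic : set R).
Local Notation lt_set b := (`]-oo, b%R[%classic : set R).
Local Notation le_set b := (`]-oo, b%R]%classic : set R).

Lemma measurable_expRM (t : R) :
  measurable_fun setT (fun x : R => (expR (- (t * x)))%:E).
Proof.
apply/measurable_EFinP; apply: measurableT_comp => //.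
by apply: measurableT_comp => //; exact: measurable_funM.
Qed.

Lemma exists_prob_le_gt (p : R) : (p < 1)%R ->
  exists c : nat, (p%:E < mu (le_set c.+1%:R))%E.
Proof.
move=> p1; pose F n := le_set n.+1%:R.
have FT : \bigcup_n F n = setT.
  apply/seteqP; split => // x _; exists (Num.bound `|x|) => //.
  rewrite /F /= in_itv /=; apply: le_trans (ler_norm x) _; apply: ltW.
  by apply: lt_le_trans (archi_boundP (normr_ge0 _)) _; rewrite ler_nat.
have ndF : {homo F : n m / (n <= m)%N >-> (n <= m)%O}.
  move=> n m nm; apply/subsetPset => x; rewrite /F /= !in_itv /= => /le_trans.
  by apply; rewrite ler_nat.
have mF n : measurable (F n) by exact: measurable_itv.
have muF : (mu \o F) n @[n --> \oo] --> 1.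
  have mFT : measurable (\bigcup_n F n) by rewrite FT.
  have := nondecreasing_cvg_mu (mu := mu) mF mFT ndF.
  by rewrite FT [X in _ --> X -> _]probability_setT.
apply: contrapT => /forallNP h.
have : 1 <= p%:E.
  move/cvg_lim : (muF) => <- //; apply: lime_le.
    by apply/cvg_ex; eexists; exact: muF.
  by apply: nearW => n /=; rewrite leNgt; apply/negP; exact: h.
by rewrite lee_fin leNgt p1.
Qed.

(** A walk started below [- c n] is still negative after [n] steps that are all at most [c], an
    event of probability at least [p ^+ n]. *)
Lemma iter_walk_op_neg_ge (c p : R) n (y : R) : (0 <= p)%R ->
  (p%:E <= mu (le_set c)) -> (y < - (c * n%:R))%R ->
  (p ^+ n)%:E <= iter n T (EFin \o \1_neg) y.
Proof.
move=> p0 pc; elim: n y => [|n ih] y.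
  rewrite mulr0 oppr0 expr0 /= => y0.
  by rewrite indicE mem_set //= in_itv.
move=> yn /=; rewrite /walk_op.
apply: (@le_trans _ _ (\int[mu]_x ((p ^+ n)%:E * (\1_(le_set c) x)%:E))).
  rewrite ge0_integralZl_EFin ?exprn_ge0//.
  - rewrite integral_indic// setIT exprSr EFinM.
    by rewrite lee_wpmul2l// lee_fin exprn_ge0.
  - by apply/measurable_EFinP; exact: measurable_indic.
apply: ge0_le_integral => //.
- by move=> x _; rewrite mule_ge0// lee_fin exprn_ge0.
- by apply: measurable_funeM; apply/measurable_EFinP; exact: measurable_indic.
- apply: measurableT_comp; last exact: measurable_funD.
  by apply: measurable_iter_walk_op; [exact: indicE_ge0|exact: measurable_indicE].
- move=> x _; rewrite indicE; case: (boolP (x \in _)) => [|_].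
    rewrite inE /= in_itv /= => xc; rewrite mule1 ih//.
    by move: yn; rewrite -natr1; nra.
  by rewrite mule0 iter_walk_op_ge0//; exact: indicE_ge0.
Qed.

Lemma tail_le_conv_pow (c p : R) n : (0 <= p)%R -> (p%:E <= mu (le_set c)) ->
  (p ^+ n)%:E * mu (lt_set (- (c * n%:R))) <= conv_pow mu n.+1 neg.
Proof.
move=> p0 pc; rewrite conv_powE /= /walk_op.
rewrite -[X in _ * mu X]setIT -integral_indic//.
rewrite -ge0_integralZl_EFin ?exprn_ge0//; last first.
  by apply/measurable_EFinP; exact: measurable_indic.
apply: ge0_le_integral => //.
- by move=> x _; rewrite mule_ge0// lee_fin exprn_ge0.
- by apply: measurable_funeM; apply/measurable_EFinP; exact: measurable_indic.
- apply: measurableT_comp; last exact: measurable_funD.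
  by apply: measurable_iter_walk_op; [exact: indicE_ge0|exact: measurable_indicE].
- move=> x _; rewrite indicE; case: (boolP (x \in _)) => [|_].
    rewrite inE /= in_itv /= => xc; rewrite mule1 add0r.
    exact: iter_walk_op_neg_ge p0 pc xc.
  by rewrite mule0 iter_walk_op_ge0//; exact: indicE_ge0.
Qed.

(** With [p] strictly between [q] and [1], the inequality [p ^+ n * mu(]-oo, - c n[) <= q ^+ n.+1]
    yields the ratio [r = q / p < 1]. *)
Lemma geometric_tail (q : R) : (0 < q < 1)%R ->
  (forall n, (1 <= n)%N -> conv_pow mu n neg <= (q ^+ n)%:E) ->
  exists c r : R, [/\ (0 < c)%R, (0 < r < 1)%R &
    forall n, mu (lt_set (- (c * n%:R))) <= (r ^+ n)%:E].
Proof.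
move=> /andP[q0 q1] hq; pose p : R := ((q + 1) / 2)%R.
have p1 : (p < 1)%R by rewrite /p; lra.
have qp : (q < p)%R by rewrite /p; lra.
have p0 : (0 < p)%R by exact: lt_trans qp.
clearbody p.
have [c hc] := exists_prob_le_gt p1.
exists c.+1%:R, (q / p)%R; split => //.
  by rewrite divr_gt0//= ltr_pdivrMr// mul1r.
move=> n; have := tail_le_conv_pow n (ltW p0) (ltW hc).
move=> /le_trans/(_ (hq n.+1 isT)).
rewrite -(fineK (fin_num_measure mu _ _))// -EFinM !lee_fin expr_div_n.
rewrite ler_pdivlMr ?exprn_gt0// mulrC => /le_trans; apply.
by rewrite exprSr ler_piMr ?exprn_ge0// ltW.
Qed.

(** Cut the negative axis into blocks of length [c]. If [- x / c] lies in []n, n+1]], then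
    [e^(-e x)] is at most [e^(e c (n+1))], and the block has mass at most [r ^+ n]. *)
Lemma laplace_lty (c r : R) : (0 < c)%R -> (0 < r < 1)%R ->
  (forall n, mu (lt_set (- (c * n%:R))) <= (r ^+ n)%:E) ->
  exists e : R, (0 < e)%R /\ laplace mu e < +oo.
Proof.
move=> c0 /andP[r0 r1] hr.
(* Writing [r ^+ n] as [s ^+ n * s ^+ n], one factor absorbs the growth of the exponential, since
   [e] is chosen with [expR (e * c) = s^-1], and the other keeps the series convergent. *)
pose s : R := Num.sqrt r.
have s0 : (0 < s)%R by rewrite sqrtr_gt0.
have s2 : (s ^+ 2 = r)%R by rewrite sqr_sqrtr// ltW.
have s1 : (s < 1)%R by rewrite -(@ltr_pXn2r _ 2)// ?nnegrE ?ltW// s2 expr1n.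
pose e : R := (- ln s / c)%R.
have e0 : (0 < e)%R by rewrite divr_gt0// oppr_gt0 ln_lt0// s0.
have ec : expR (e * c) = (s^-1)%R.
  by rewrite /e divfK ?gt_eqF// expRN lnK.
exists e; split=> //.
pose tail n x := (s ^- n.+1)%:E * (\1_(lt_set (- (c * n%:R))) x)%:E.
have tail0 n x : 0 <= tail n x.
  by rewrite mule_ge0// lee_fin invr_ge0 exprn_ge0// ltW.
have mtail n : measurable_fun setT (tail n).
  by apply: measurable_funeM; apply/measurable_EFinP; exact: measurable_indic.
have bound x : (expR (- (e * x)))%:E <= 1 + \sum_(n <oo) tail n x.
  have sum0 : 0 <= \sum_(n <oo) tail n x by apply: nneseries_ge0.
  have [x0|x0] := leP 0%R x.
    apply: (@le_trans _ _ 1); last by rewrite leeDl.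
    by rewrite lee_fin expR_le1 oppr_le0 mulr_ge0// ltW.
  have v0 : (0 < - x / c)%R by rewrite divr_gt0// oppr_gt0.
  have [n /andP[nv vn]] := exists_natr_itv v0.
  apply: (@le_trans _ _ (tail n x)).
    rewrite /tail indicE mem_set /= ?mule1; last first.
      by move: nv; rewrite in_itv /= ltr_pdivlMr//; lra.
    rewrite lee_fin -exprVn -ec -expRM_natl ler_expR.
    have : (- x <= n.+1%:R * c)%R by rewrite -ler_pdivrMr.
    by rewrite -mulrN mulrCA ler_pM2l.
  apply: (@le_trans _ _ (\sum_(n <oo) tail n x)); last by rewrite leeDr.
  apply: le_trans (nneseries_lim_ge n.+1 _); last by [].
  by rewrite big_nat_recr//= leeDr// sume_ge0.
have msum : measurable_fun setT (fun x => \sum_(n <oo) tail n x).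
  exact: (ge0_emeasurable_sum (P := xpredT)).
rewrite /laplace.
apply: (@le_lt_trans _ _ (\int[mu]_x (1 + \sum_(n <oo) tail n x))).
  apply: ge0_le_integral => //.
  - exact: measurable_expRM.
  - by apply: emeasurable_funD; [exact: measurable_cst|exact: msum].
rewrite ge0_integralD//; last by move=> x _; apply: nneseries_ge0.
rewrite integral_cst//= probability_setT mule1 lte_add_pinfty ?ltry//.
rewrite integral_nneseries//.
apply: (@le_lt_trans _ _ (s^-1 / (1 - s))%:E); last exact: ltry.
apply: lime_le.
  by apply: is_cvg_nneseries => n _ _; exact: integral_ge0.
apply: nearW => n.
apply: (@le_trans _ _ (series (geometric s^-1 s) n)%:E); last first.
  by rewrite lee_fin geometric_le_lim// ?invr_ge0 ?ltW// gtr0_norm.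
rewrite /series /= -sumEFin lee_sum// => k _.
rewrite /tail ge0_integralZl_EFin//; last 2 first.
  by apply/measurable_EFinP; exact: measurable_indic.
  by rewrite invr_ge0 exprn_ge0// ltW.
rewrite integral_indic// setIT.
apply: (@le_trans _ _ ((s ^- k.+1)%:E * (r ^+ k)%:E)).
  apply: lee_wpmul2l; last exact: hr.
  by rewrite lee_fin invr_ge0 exprn_ge0// ltW.
have sk0 : (s ^+ k != 0)%R by rewrite expf_neq0// gt_eqF.
rewrite -EFinM lee_fin -s2 exprAC exprSr le_eqVlt; apply/orP; left; apply/eqP.
by field; rewrite sk0 gt_eqF.
Qed.

Lemma condE_laplace_lty : condE mu -> 0 < mu neg ->
  exists e : R, (0 < e)%R /\ laplace mu e < +oo.
Proof.
move=> h mu0; have [q [q01 hq]] := condE_all h mu0.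
have [c [r [c0 r01 hr]]] := geometric_tail q01 hq.
exact: laplace_lty hr.
Qed.

End exponential_tail.

(** * Elementary tools for comparing two laws *)

Lemma same_pos_restrictions_sym (R : realType) (mu1 mu : probability R R) :
  same_pos_restrictions mu1 mu -> same_pos_restrictions mu mu1.
Proof. by move=> same n n1 A mA sA; rewrite same. Qed.

(** The sum counts the integers from [1] to [N] that are at most [v], hence equals the minimum of
    [N] and the integer part of [v]. This controls the error of a layer-cake approximation. *)
Lemma count_floor (R : realType) (N : nat) (v : R) : 0 <= v ->
  \sum_(j < N) ((j.+1%:R <= v)%R : bool)%:R <= v /\
  (v <= N%:R -> v <= \sum_(j < N) ((j.+1%:R <= v)%R : bool)%:R + 1 :> R).
Proof.
move=> v0; have full M : M%:R <= v -> \sum_(j < M) ((j.+1%:R <= v)%R : bool)%:R = M%:R :> R.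
  move=> Mv; rewrite (eq_bigr (fun _ => 1)) ?sumr_const ?card_ord// => j _.
  by rewrite (le_trans _ Mv)// ler_nat.
elim: N => [|N [ih1 ih2]].
  by rewrite big_ord0; split => // vN; rewrite (le_trans vN)// add0r.
rewrite big_ord_recr /=; split.
  case: (leP N.+1%:R v) => [vN|_]; last by rewrite addr0.
  rewrite full; first by rewrite natr1.
  by rewrite (le_trans _ vN)// ler_nat.
move=> vN; case: (leP v N%:R) => [/ih2/le_trans|/ltW/full ->].
  by apply; rewrite lerD2r lerDl.
by rewrite (le_trans vN)// -natr1 lerD2r lerDl.
Qed.

(** If [y < x], then [m = max(y, r) < x], and dividing by [m ^+ n] bounds [(x / m) ^+ n] by
    [1 + |C|] for all [n >= 1], which is absurd. *)
Lemma exp_gap_le (R : realType) (x y r C : R) : 0 <= y -> 0 < r < x ->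
  (forall n, (1 <= n)%N -> x ^+ n <= y ^+ n + C * r ^+ n) -> x <= y.
Proof.
move=> y0 /andP[r0 rx] h; rewrite leNgt; apply/negP => yx.
pose m := Num.max y r.
have m0 : 0 < m by rewrite lt_max r0 orbT.
have mx : m < x by rewrite gt_max yx.
have [k hk] : exists k0 : nat, forall k, (k0 <= k)%N -> 1 + `|C| < (x / m) ^+ k.
  by apply: expr_unbounded; rewrite ltr_pdivlMr// mul1r.
have := hk k.+1 (leqnSn k); rewrite ltNge => /negP; apply.
rewrite expr_div_n ler_pdivrMr ?exprn_gt0// (le_trans (h k.+1 isT))//.
rewrite mulrDl mul1r lerD//.
  by rewrite lerXn2r ?nnegrE ?(ltW m0)// le_max lexx.
rewrite (@le_trans _ _ (`|C| * r ^+ k.+1))//.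
  by apply: ler_wpM2r; [rewrite exprn_ge0// ltW|exact: ler_norm].
by rewrite ler_wpM2l// lerXn2r ?nnegrE ?(ltW r0) ?(ltW m0)// le_max lexx orbT.
Qed.

(** * Powers of the Laplace transform and their negative part *)

Section laplace_power.
Context {R : realType} (mu : probability R R).
Local Open Scope ereal_scope.

Local Notation T := (walk_op mu).
Local Notation neg := (`]-oo, 0%R[%classic : set R).
Local Notation le_set b := (`]-oo, b%R]%classic : set R).

Definition exp_on (A : set R) (t x : R) : \bar R :=
  (expR (- (t * x)) * \1_A x)%:E.

Lemma exp_on_ge0 (A : set R) t x : 0 <= exp_on A t x.
Proof. by rewrite lee_fin mulr_ge0// expR_ge0. Qed.

Lemma measurable_exp_on (A : set R) t : measurable A ->
  measurable_fun setT (exp_on A t).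
Proof.
move=> mA; apply/measurable_EFinP; apply: measurable_funM.
  by apply/measurable_EFinP; exact: measurable_expRM.
exact: measurable_indic.
Qed.

Lemma laplace_ge0 t : 0 <= laplace mu t.
Proof. by apply: integral_ge0 => x _; rewrite lee_fin expR_ge0. Qed.

(** The exponential is an eigenfunction of the averaging operator, with eigenvalue
    [laplace mu t]. *)
Lemma iter_walk_op_expR t (f : R) n : laplace mu t = f%:E ->
  iter n T (fun x => (expR (- (t * x)))%:E) 0%R = (f ^+ n)%:E.
Proof.
move=> tf; have f0 : (0 <= f)%R by rewrite -lee_fin -tf laplace_ge0.
suff -> : iter n T (fun x => (expR (- (t * x)))%:E) =
    (fun y => (f ^+ n * expR (- (t * y)))%:E).
  by rewrite mulr0 oppr0 expR0 mulr1.
elim: n => [|n ih] /=; first by apply/funext => y; rewrite expr0 mul1r.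
rewrite ih; apply/funext => y; rewrite /walk_op.
under eq_integral.
  move=> x _; rewrite mulrDr opprD expRD mulrA EFinM; over.
rewrite ge0_integralZl_EFin//.
- by rewrite -/(laplace mu t) tf -EFinM exprSr mulrAC.
- exact: measurable_expRM.
- by rewrite mulr_ge0 ?exprn_ge0 ?expR_ge0.
Qed.

Lemma laplace_lty_le (e t : R) : (0 <= t <= e)%R -> laplace mu e < +oo ->
  laplace mu t < +oo.
Proof.
move=> /andP[t0 te] he.
apply: (@le_lt_trans _ _ (\int[mu]_x (1 + (expR (- (e * x)))%:E))).
  apply: ge0_le_integral => //.
  - exact: measurable_expRM.
  - by apply: emeasurable_funD; [exact: measurable_cst|exact: measurable_expRM].
  - move=> x _; rewrite -EFinD lee_fin; have [x0|x0] := leP 0%R x.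
      apply: (@le_trans _ _ 1%R); last by rewrite lerDl expR_ge0.
      by rewrite expR_le1 oppr_le0 mulr_ge0.
    apply: (@le_trans _ _ (expR (- (e * x)))); last by rewrite lerDr.
    by rewrite ler_expR lerN2 ler_wnM2r// ltW.
rewrite ge0_integralD//; last exact: measurable_expRM.
by rewrite integral_cst//= probability_setT mule1 lte_add_pinfty ?ltry.
Qed.

(** Keep only a half-line []-oo, c]] of mass above [p > r], on which [e^(-t x) >= e^(-t c)]. *)
Lemma laplace_gt (r : R) : (0 < r < 1)%R -> exists d : R, (0 < d)%R /\
  forall t, (0 < t < d)%R -> r%:E < laplace mu t.
Proof.
move=> /andP[r0 r1]; pose p : R := ((r + 1) / 2)%R.
have p1 : (p < 1)%R by rewrite /p; lra.
have rp : (r < p)%R by rewrite /p; lra.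
have p0 : (0 < p)%R by exact: lt_trans rp.
clearbody p.
have [c0 hc] := exists_prob_le_gt mu p1.
pose c : R := c0.+1%:R; have cpos : (0 < c)%R by rewrite ltr0n.
rewrite -/c in hc; clearbody c.
have lnpos : (0 < ln (p / r))%R by rewrite ln_gt0// ltr_pdivlMr// mul1r.
(* This [d] solves [p * expR (- (d * c)) = r]. *)
exists (ln (p / r) / c)%R; split; first by rewrite divr_gt0.
move=> t /andP[t0 td].
apply: (@lt_le_trans _ _ (\int[mu]_x ((expR (- (t * c)))%:E * (\1_(le_set c) x)%:E))).
  rewrite ge0_integralZl_EFin//; last first.
    by apply/measurable_EFinP; exact: measurable_indic.
  rewrite integral_indic// setIT.
  apply: (@lt_le_trans _ _ ((expR (- (t * c)))%:E * p%:E)); last first.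
    by apply: lee_wpmul2l; [rewrite lee_fin expR_ge0|exact: ltW].
  rewrite -EFinM lte_fin expRN mulrC ltr_pdivlMr ?expR_gt0//.
  rewrite mulrC -ltr_pdivlMr// -[ltRHS]lnK ?posrE ?divr_gt0// ltr_expR.
  by rewrite -ltr_pdivlMr.
apply: ge0_le_integral => //.
- by apply: measurable_funeM; apply/measurable_EFinP; exact: measurable_indic.
- exact: measurable_expRM.
- move=> x _; rewrite -EFinM lee_fin indicE; case: (boolP (x \in _)) => [|_].
    by rewrite inE /= in_itv /= mulr1 => xc; rewrite ler_expR lerN2 ler_pM2l.
  by rewrite mulr0 expR_ge0.
Qed.

(** Split at [- L]. On [[- L, 0[] the integrand is at most [e^(t L)]; below [- L],
    [e^(-t x) = e^((e - t) x) e^(-e x)] is at most [e^(-(e - t) L) e^(-e x)], as in a Chernoff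
    bound. *)
Lemma iter_walk_op_exp_neg_le (e t L f : R) n :
  (0 <= t <= e)%R -> (0 <= L)%R -> laplace mu e = f%:E ->
  iter n T (exp_on neg t) 0%R <=
  (expR (t * L))%:E * conv_pow mu n neg +
  (expR (- ((e - t) * L)) * f ^+ n)%:E.
Proof.
move=> /andP[t0 te] L0 hf.
rewrite EFinM -(iter_walk_op_expR n hf) conv_powE.
have mneg : measurable neg by [].
have e0 x : 0 <= (expR (- (e * x)))%:E by rewrite lee_fin expR_ge0.
have := congr1 (@^~ 0%R) (iter_walk_opZ mu n (expR_ge0 (t * L))
  (@indicE_ge0 _ neg) (measurable_indicE mneg)); rewrite /= => <-.
have := congr1 (@^~ 0%R) (iter_walk_opZ mu n (expR_ge0 (- ((e - t) * L)))
  e0 (measurable_expRM e)); rewrite /= => <-.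
pose f1 (x : R) := (expR (t * L))%:E * (\1_neg x)%:E.
pose f2 (x : R) := (expR (- ((e - t) * L)))%:E * (expR (- (e * x)))%:E.
have f10 x : 0 <= f1 x by rewrite /f1 -EFinM lee_fin mulr_ge0// expR_ge0.
have f20 x : 0 <= f2 x by rewrite /f2 -EFinM lee_fin mulr_ge0// expR_ge0.
have mf1 : measurable_fun setT f1.
  by apply: measurable_funeM; apply/measurable_EFinP; exact: measurable_indic.
have mf2 : measurable_fun setT f2.
  by apply: measurable_funeM; exact: measurable_expRM.
have := congr1 (@^~ 0%R) (iter_walk_opD mu n f10 mf1 f20 mf2); rewrite /= => <-.
apply: le_iter_walk_op.
- exact: exp_on_ge0.
- exact: measurable_exp_on.
- exact: emeasurable_funD.
- move=> x; rewrite /exp_on /f1 /f2 -!EFinM -EFinD lee_fin indicE.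
  case: (boolP (x \in _)) => [|_]; last first.
    by rewrite !mulr0 add0r mulr_ge0// expR_ge0.
  rewrite inE /= in_itv /= => x0; rewrite !mulr1.
  have [xL|xL] := leP (- L)%R x.
    apply: (@le_trans _ _ (expR (t * L))).
      by rewrite ler_expR -mulrN ler_wpM2l// lerNl.
    by rewrite lerDl mulr_ge0// expR_ge0.
  apply: (@le_trans _ _ (expR (- ((e - t) * L)) * expR (- (e * x)))%R).
    rewrite -expRD ler_expR; nra.
  by rewrite lerDr expR_ge0.
Qed.

(** Take the cut [L = c n] in the previous bound. First [c] is made large, so that the far part
    decays geometrically, and then [t] small, so that [e^(t c) q <= r] for the near part. *)
Lemma exp_neg_geometric (q e : R) : (0 < q < 1)%R ->
  (forall n, (1 <= n)%N -> conv_pow mu n neg <= (q ^+ n)%:E) ->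
  (0 < e)%R -> laplace mu e < +oo ->
  exists d r : R, [/\ (0 < d)%R, (0 < r < 1)%R & forall t, (0 < t < d)%R ->
    laplace mu t < +oo /\ forall n, (1 <= n)%N ->
    iter n T (exp_on neg t) 0%R <= (2 * r ^+ n)%:E].
Proof.
move=> /andP[q0 q1] hq e0 he.
have [f hf] : exists f : R, laplace mu e = f%:E.
  by exists (fine (laplace mu e)); rewrite fineK// ge0_fin_numE// laplace_ge0.
have f0 : (0 <= f)%R by rewrite -lee_fin -hf laplace_ge0.
pose r : R := ((q + 1) / 2)%R.
have r1 : (r < 1)%R by rewrite /r; lra.
have qr : (q < r)%R by rewrite /r; lra.
have r0 : (0 < r)%R by exact: lt_trans qr.
clearbody r.
(* Chosen to make [expR (- (e / 2 * c)) * f <= q]; [f + 1] keeps the argument of the logarithm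
   positive. *)
pose c : R := ((1 + `|ln ((f + 1) / q)|) * 2 / e)%R.
have c0 : (0 < c)%R.
  by rewrite divr_gt0// mulr_gt0// ltr_pwDl.
have fq : (expR (- (e / 2 * c)) * f <= q)%R.
  have fq0 : (0 < (f + 1) / q)%R by rewrite divr_gt0// ltr_pwDr.
  rewrite expRN mulrC ler_pdivrMr ?expR_gt0// mulrC -ler_pdivrMr//.
  apply: (@le_trans _ _ ((f + 1) / q)%R).
    by rewrite ler_pM2r ?invr_gt0// lerDl.
  rewrite -[leLHS]lnK ?posrE// ler_expR.
  have -> : (e / 2 * c = 1 + `|ln ((f + 1) / q)|)%R.
    by rewrite /c; field; rewrite gt_eqF.
  by rewrite (le_trans (ler_norm _))// lerDr.
clearbody c.
have lnpos : (0 < ln (r / q))%R by rewrite ln_gt0// ltr_pdivlMr// mul1r.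
(* The first bound gives [e - t >= e / 2] for the far part, the second gives [expR (t * c) * q <= r]
   for the near part. *)
exists (Num.min (e / 2) (ln (r / q) / c))%R, r; split.
- by rewrite lt_min !divr_gt0.
- by rewrite r0.
move=> t; rewrite lt_min => /andP[t0 /andP[te tc]].
split; first by apply: laplace_lty_le he; rewrite ltW//=; lra.
move=> n n1.
have tle : (0 <= t <= e)%R by rewrite ltW//=; lra.
have L0 : (0 <= c * n%:R)%R by rewrite mulr_ge0// ltW.
apply: le_trans (iter_walk_op_exp_neg_le n tle L0 hf) _.
have -> : (2 * r ^+ n = r ^+ n + r ^+ n)%R by rewrite mulr_natl mulr2n.
rewrite EFinD; apply: leeD.
  apply: (@le_trans _ _ ((expR (t * (c * n%:R)))%:E * (q ^+ n)%:E)).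
    by apply: lee_wpmul2l; [rewrite lee_fin expR_ge0|exact: hq].
  rewrite -EFinM lee_fin.
  have -> : (t * (c * n%:R) = n%:R * (t * c))%R by ring.
  rewrite expRM_natl -exprMn lerXn2r ?nnegrE ?mulr_ge0 ?expR_ge0 ?(ltW q0) ?(ltW r0)//.
  rewrite -ler_pdivlMr// -[leRHS]lnK ?posrE ?divr_gt0// ler_expR.
  by rewrite -ler_pdivlMr// ltW.
rewrite lee_fin.
have -> : (- ((e - t) * (c * n%:R)) = n%:R * - ((e - t) * c))%R by ring.
rewrite expRM_natl -exprMn lerXn2r ?nnegrE ?mulr_ge0 ?expR_ge0 ?(ltW r0)//.
apply: le_trans (ltW qr); apply: le_trans fq.
by rewrite ler_wpM2r// ler_expR lerN2 ler_pM2r//; lra.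
Qed.

End laplace_power.

(** * The restrictions determine the Laplace transform near 0 *)

Section laplace_determined.
Context {R : realType}.
Local Open Scope ereal_scope.
Implicit Types mu nu : probability R R.

Local Notation neg := (`]-oo, 0%R[%classic : set R).
Local Notation pos := (`[0%R, +oo[%classic : set R).

(* Layer-cake discretisation of [g] at height [1/N], which only involves
   indicators of subsets of the half-line [0, +oo[. *)
Lemma iter_walk_op_pos_le mu nu n (g : R -> R) : same_pos_restrictions mu nu ->
  (1 <= n)%N -> measurable_fun setT g -> (forall x, 0 <= g x <= 1)%R ->
  (forall x, (x < 0)%R -> g x = 0%R) ->
  iter n (walk_op mu) (EFin \o g) 0%R <= iter n (walk_op nu) (EFin \o g) 0%R.
Proof.
move=> same n1 mg g01 gneg.
have g0 x : (0 <= g x)%R by have /andP[] := g01 x.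
have mEg : measurable_fun setT (EFin \o g) by exact/measurable_EFinP.
apply/lee_addgt0Pr => eps eps0.
pose N := (Num.bound eps^-1).+1.
have N0 : (0 < N%:R :> R)%R by rewrite ltr0n.
have Neps : (N%:R^-1 <= eps)%R.
  rewrite -[leRHS]invrK lef_pV2 ?posrE ?invr_gt0//.
  apply: ltW; apply: lt_le_trans (archi_boundP _) _; first by rewrite invr_ge0 ltW.
  by rewrite ler_nat.
pose B j := [set x : R | (j.+1%:R <= N%:R * g x)%R].
have mB j : measurable (B j).
  have -> : B j = setT `&` (fun x => N%:R * g x)%R @^-1` `[j.+1%:R, +oo[%classic.
    by apply/seteqP; split => x /=; rewrite ?in_itv /= ?andbT => // -[].
  by apply: (measurable_funM (measurable_cst _) mg).
have Bpos j : B j `<=` pos.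
  move=> x /=; rewrite /B /= in_itv /= andbT => Bx.
  rewrite leNgt; apply/negP => /gneg gx.
  by move: Bx; rewrite gx mulr0 leNgt ltr0n.
pose F (j : 'I_N) (x : R) : \bar R := (N%:R^-1)%:E * (EFin \o \1_(B j)) x.
have F0 j x : 0 <= F j x.
  by rewrite mule_ge0// lee_fin ?invr_ge0// indicE.
have mF j : measurable_fun setT (F j).
  by apply: measurable_funeM; exact: measurable_indicE.
have sumFE x : \sum_(j <- enum 'I_N) F j x =
    (N%:R^-1 * \sum_(j < N) ((j.+1%:R <= N%:R * g x)%R : bool)%:R)%:E.
  rewrite mulr_sumr -sumEFin big_enum /=; apply: eq_bigr => j _.
  rewrite /F /= indicE EFinM; congr (_ * (nat_of_bool _)%:R%:E).
  by apply/idP/idP; rewrite in_setE.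
have Ng0 x : (0 <= N%:R * g x)%R by rewrite mulr_ge0.
have FE : iter n (walk_op mu) (fun x => \sum_(j <- enum 'I_N) F j x) 0%R =
    iter n (walk_op nu) (fun x => \sum_(j <- enum 'I_N) F j x) 0%R.
  have iF (m : probability R R) j : iter n (walk_op m) (F j) 0%R =
      (N%:R^-1)%:E * conv_pow m n (B j).
    rewrite conv_powE /F iter_walk_opZ//.
      exact: indicE_ge0.
    exact: measurable_indicE.
  rewrite !iter_walk_op_sum//; apply: eq_bigr => j _.
  by rewrite !iF same.
have Fm : measurable_fun setT (fun x => \sum_(j <- enum 'I_N) F j x).
  by apply: emeasurable_sum.
have Fge0 x : 0 <= \sum_(j <- enum 'I_N) F j x by exact: sume_ge0.
apply: (@le_trans _ _ (iter n (walk_op mu)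
    (fun x => \sum_(j <- enum 'I_N) F j x + (cst (N%:R^-1)%:E) x) 0%R)).
  apply: le_iter_walk_op => //.
  - by apply: emeasurable_funD => //; exact: measurable_cst.
  - move=> x; rewrite sumFE -EFinD lee_fin -[X in (_ + X)%R]mulr1 -mulrDr.
    rewrite ler_pdivlMl//; apply: (count_floor N (Ng0 x)).2.
    by rewrite ler_piMr//; have /andP[] := g01 x.
rewrite iter_walk_opD//; last by move=> x /=; rewrite lee_fin invr_ge0.
rewrite iter_walk_op_cst FE; apply: leeD; last by rewrite lee_fin.
apply: le_iter_walk_op => // x.
rewrite sumFE lee_fin ler_pdivrMl//.
exact: (count_floor N (Ng0 x)).1.
Qed.

Lemma iter_walk_op_exp_pos mu nu n (t : R) : same_pos_restrictions mu nu ->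
  (1 <= n)%N -> (0 <= t)%R ->
  iter n (walk_op mu) (exp_on pos t) 0%R = iter n (walk_op nu) (exp_on pos t) 0%R.
Proof.
move=> same n1 t0; pose g (x : R) := (expR (- (t * x)) * \1_pos x)%R.
have mg : measurable_fun setT g.
  by apply/measurable_EFinP; exact: (@measurable_exp_on _ pos).
have g01 x : (0 <= g x <= 1)%R.
  rewrite /g indicE; case: (boolP (x \in _)) => [|_]; last by rewrite mulr0 lexx ler01.
  rewrite inE /= in_itv /= andbT mulr1 => x0; rewrite expR_ge0 expR_le1.
  by rewrite oppr_le0 mulr_ge0.
have gneg x : (x < 0)%R -> g x = 0%R.
  move=> x0; rewrite /g indicE memNset ?mulr0//= in_itv /= andbT.
  by apply/negP; rewrite -ltNge.
apply/eqP; rewrite eq_le; apply/andP; split.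
  exact: (@iter_walk_op_pos_le mu nu n g).
apply: (@iter_walk_op_pos_le nu mu n g) => //.
exact: same_pos_restrictions_sym.
Qed.

Lemma iter_walk_op_exp_split mu n (t f : R) : laplace mu t = f%:E ->
  (f ^+ n)%:E = iter n (walk_op mu) (exp_on pos t) 0%R +
                iter n (walk_op mu) (exp_on neg t) 0%R.
Proof.
move=> hf; rewrite -(iter_walk_op_expR n hf).
have := congr1 (@^~ 0%R) (iter_walk_opD mu n (@exp_on_ge0 _ pos t)
  (measurable_exp_on t (measurable_itv _)) (@exp_on_ge0 _ neg t)
  (measurable_exp_on t (measurable_itv _))).
rewrite /= => <-; congr (iter n _ _ _); apply/funext => x.
rewrite /exp_on -EFinD -mulrDr !indicE -setCitvl in_setC.
by case: (x \in _); rewrite /= ?addr0 ?add0r mulr1.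
Qed.

(** Let [x] and [y] be the two transforms at [t]. The parts of [x ^+ n] and [y ^+ n] carried by [[0,
    +oo[] agree, and the negative part of [x ^+ n] is at most [2 r ^+ n], so
    [x ^+ n <= y ^+ n + 2 r ^+ n]. For [t] small [x > r], and the exponential gap forces
    [x <= y]. *)
Lemma laplace_le mu nu : same_pos_restrictions mu nu -> condE mu ->
  0 < mu neg -> exists d : R, (0 < d)%R /\ forall t, (0 < t < d)%R ->
    laplace mu t < +oo /\ laplace mu t <= laplace nu t.
Proof.
move=> same hE mu0; have [q [q01 hq]] := condE_all hE mu0.
have [e [e0 he]] := condE_laplace_lty hE mu0.
have [d1 [r [d10 r01 hr]]] := exp_neg_geometric q01 hq e0 he.
have [d2 [d20 hd2]] := laplace_gt mu r01.
exists (Num.min d1 d2); split; first by rewrite lt_min d10.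
move=> t; rewrite lt_min => /andP[t0 /andP[td1 td2]].
have [|tfin hn] := hr t; first by rewrite t0.
split => //.
(* Finiteness of the transform of [nu] is not known at this stage; where it is infinite the
   inequality is trivial. *)
have [[y hy]|hy] : (exists y, laplace nu t = y%:E) \/ laplace nu t = +oo.
- have := laplace_ge0 nu t; case: (laplace nu t) => [y _| _|//].
    by left; exists y.
  by right.
- have [x hx] : exists x : R, laplace mu t = x%:E.
    by exists (fine (laplace mu t)); rewrite fineK// ge0_fin_numE// laplace_ge0.
  rewrite hx hy lee_fin.
  have y0 : (0 <= y)%R by rewrite -lee_fin -hy laplace_ge0.
  apply: (@exp_gap_le _ x y r 2) => //.
    have /andP[-> _]/= := r01; rewrite -lte_fin -hx.
    by apply: hd2; rewrite t0.
  move=> n n1; rewrite -lee_fin EFinD.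
  rewrite (iter_walk_op_exp_split n hx) (iter_walk_op_exp_split n hy).
  rewrite (iter_walk_op_exp_pos same n1 (ltW t0)).
  apply: leeD; last exact: hn.
  by rewrite leeDl// iter_walk_op_ge0//; exact: exp_on_ge0.
- by rewrite hy leey.
Qed.

Lemma walk_op1_exp_on mu (A : set R) (t : R) : measurable A ->
  iter 1 (walk_op mu) (exp_on A t) 0%R =
  \int[mu]_(x in A) (expR (- (t * x)))%:E.
Proof.
move=> mA; rewrite /= /walk_op [RHS]integral_mkcond.
apply: eq_integral => x _; rewrite add0r /exp_on /patch indicE.
by case: ifP => _; rewrite ?mulr1 ?mulr0.
Qed.

(** Condition (E) passes to [nu], so the comparison holds in both directions. Subtracting the common
    finite contribution [P] of [[0, +oo[] leaves the negative parts. *)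
Lemma laplace_neg_eq mu nu : same_pos_restrictions mu nu -> condE mu ->
  0 < mu neg -> exists d : R, (0 < d)%R /\ forall t, (0 < t < d)%R ->
    \int[mu]_(x in neg) (expR (- (t * x)))%:E < +oo /\
    \int[mu]_(x in neg) (expR (- (t * x)))%:E =
    \int[nu]_(x in neg) (expR (- (t * x)))%:E.
Proof.
move=> same hE mu0; have mneg : measurable neg by [].
have same' := same_pos_restrictions_sym same.
have nu0 : 0 < nu neg.
  rewrite -(conv_pow1 nu mneg) -(same_pos_conv_pow_neg same)//.
  by rewrite conv_pow1.
have hE' : condE nu by exact/(same_pos_condE same).
have [d1 [d10 h1]] := laplace_le same hE mu0.
have [d2 [d20 h2]] := laplace_le same' hE' nu0.
exists (Num.min d1 d2); split; first by rewrite lt_min d10.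
move=> t; rewrite lt_min => /andP[t0 /andP[td1 td2]].
have [|mufin mule] := h1 t; first by rewrite t0.
have [|nufin nule] := h2 t; first by rewrite t0.
have [x hx] : exists x : R, laplace mu t = x%:E.
  by exists (fine (laplace mu t)); rewrite fineK// ge0_fin_numE// laplace_ge0.
have hy : laplace nu t = x%:E.
  by rewrite -hx; apply/eqP; rewrite eq_le nule mule.
rewrite -!walk_op1_exp_on//.
have := iter_walk_op_exp_split 1 hx; have := iter_walk_op_exp_split 1 hy.
rewrite (iter_walk_op_exp_pos same (leqnn 1) (ltW t0)).
set P := iter 1 _ (exp_on pos t) _.
have P0 : 0 <= P by rewrite iter_walk_op_ge0//; exact: exp_on_ge0.
set b := iter 1 _ (exp_on neg t) _; set a := iter 1 _ (exp_on neg t) _.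
have a0 : 0 <= a by rewrite iter_walk_op_ge0//; exact: exp_on_ge0.
move=> hb ha.
have Pfin : P \is a fin_num.
  rewrite ge0_fin_numE//; apply: (@le_lt_trans _ _ (x ^+ 1)%:E); last exact: ltry.
  by rewrite ha leeDl.
split.
  apply: (@le_lt_trans _ _ (x ^+ 1)%:E); last exact: ltry.
  by rewrite ha leeDr.
by rewrite -[LHS](addeK _ Pfin) -[RHS](addeK _ Pfin) ![_ + P]addeC -ha -hb.
Qed.

End laplace_determined.

(** * Test functions with equal weighted integrals *)

(** Boundedness of [g] is part of the definition so that, for an integrable weight [w], every
    product [g w] is integrable and linear combinations stay in the class. *)
Definition eq_weighted_integral (d : measure_display) (T : measurableType d)
    (R : realType) (m1 m2 : {measure set T -> \bar R}) (D : set T)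
    (w g : T -> R) : Prop :=
  [/\ measurable_fun D g, exists M : R, forall x, D x -> `|g x| <= M &
    (\int[m1]_(x in D) (g x * w x)%:E = \int[m2]_(x in D) (g x * w x)%:E)%E].

Section eq_weighted_integral.
Context (d : measure_display) (T : measurableType d) (R : realType).
Context (m1 m2 : {measure set T -> \bar R}) (D : set T) (mD : measurable D).
Context (w : T -> R).
Hypothesis w1 : m1.-integrable D (EFin \o w).
Hypothesis w2 : m2.-integrable D (EFin \o w).
Local Open Scope ereal_scope.
Implicit Types g : T -> R.

Local Notation good := (eq_weighted_integral m1 m2 D w).

Let mw : measurable_fun D w.
Proof. by apply/measurable_EFinP; exact: measurable_int w1. Qed.

Let integrable_bounded (m : {measure set T -> \bar R}) g :
  m.-integrable D (EFin \o w) -> measurable_fun D g ->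
  (exists M : R, forall x, D x -> `|g x| <= M)%R ->
  m.-integrable D (fun x => (g x * w x)%:E).
Proof.
move=> mwi mg [M gM].
have := integrableZl mD M mwi; apply: le_integrable => //.
  by apply/measurable_EFinP; exact: measurable_funM.
move=> x Dx /=; rewrite lee_fin !normrM ler_wpM2r//.
by rewrite (le_trans (gM x Dx))// ler_norm.
Qed.

Lemma eq_weighted_integralD g1 g2 : good g1 -> good g2 ->
  good (fun x => g1 x + g2 x)%R.
Proof.
move=> [mg1 bg1 e1] [mg2 bg2 e2]; split.
- exact: measurable_funD.
- have [M1 h1] := bg1; have [M2 h2] := bg2; exists (M1 + M2)%R => x Dx.
  by rewrite (le_trans (ler_normD _ _))// lerD ?h1 ?h2.
- under eq_integral do rewrite mulrDl EFinD.
  under [RHS]eq_integral do rewrite mulrDl EFinD.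
  by rewrite !integralD ?e1 ?e2//; exact: integrable_bounded.
Qed.

Lemma eq_weighted_integralZ (k : R) g : good g -> good (fun x => k * g x)%R.
Proof.
move=> [mg bg e]; split.
- exact: measurable_funM.
- have [M h] := bg; exists (`|k| * M)%R => x Dx.
  by rewrite normrM ler_wpM2l// h.
- under eq_integral do rewrite -mulrA EFinM.
  under [RHS]eq_integral do rewrite -mulrA EFinM.
  by rewrite !integralZl ?e//; exact: integrable_bounded.
Qed.

Lemma eq_weighted_integralB g1 g2 : good g1 -> good g2 ->
  good (fun x => g1 x - g2 x)%R.
Proof.
move=> h1 h2; have := eq_weighted_integralD h1 (eq_weighted_integralZ (-1) h2).
by under eq_fun do rewrite mulN1r.
Qed.

Lemma eq_weighted_integral0 : good (fun=> 0%R).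
Proof.
split; first exact: measurable_cst.
  by exists 0%R => x _; rewrite normr0.
by under eq_integral do rewrite mul0r; under [RHS]eq_integral do rewrite mul0r;
  rewrite !integral0.
Qed.

Lemma eq_weighted_integral_sum (I : Type) (s : seq I) (G : I -> T -> R) :
  (forall i, good (G i)) -> good (fun x => \sum_(i <- s) G i x)%R.
Proof.
move=> hG; elim: s => [|i s ih].
  by under eq_fun do rewrite big_nil; exact: eq_weighted_integral0.
by under eq_fun do rewrite big_cons; exact: eq_weighted_integralD.
Qed.

Lemma eq_weighted_integral_ext g1 g2 : (forall x, D x -> g1 x = g2 x) ->
  good g1 -> good g2.
Proof.
move=> e12 [mg [M bg] e]; split.
- by apply: eq_measurable_fun mg => x; rewrite inE => /e12.
- by exists M => x Dx; rewrite -e12// bg.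
- have E (m : {measure set T -> \bar R}) : \int[m]_(x in D) (g2 x * w x)%:E =
      \int[m]_(x in D) (g1 x * w x)%:E.
    by apply: eq_integral => x; rewrite inE => /e12 ->.
  by rewrite !E.
Qed.

(** Dominated convergence for both measures, with dominating function [|M w|]. *)
Lemma eq_weighted_integral_cvg (G : nat -> T -> R) g (M : R) :
  (forall n, good (G n)) -> (forall n x, D x -> `|G n x| <= M)%R ->
  (forall x, D x -> G n x @[n --> \oo] --> g x) -> good g.
Proof.
move=> hG bG cG.
have mG n : measurable_fun D (G n) by have [] := hG n.
have mg : measurable_fun D g by exact: measurable_fun_cvg cG.
have bg x : D x -> (`|g x| <= M)%R.
  move=> Dx.
  have cn : `|G n x|%R @[n --> \oo] --> `|g x|%R by apply: cvg_norm; exact: cG.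
  rewrite -(cvg_lim _ cn)//; apply: limr_le; first by apply/cvg_ex; eexists; exact: cn.
  by apply: nearW => n; exact: bG.
have lim (m : {measure set T -> \bar R}) : m.-integrable D (EFin \o w) ->
    \int[m]_(x in D) (G n x * w x)%:E @[n --> \oo] -->
    \int[m]_(x in D) (g x * w x)%:E.
  move=> mwi.
  have [] := @dominated_convergence _ _ _ m D mD (fun n x => (G n x * w x)%:E)
    (fun x => (g x * w x)%:E) (fun x => `|M%:E * (w x)%:E|).
  - by move=> n; apply/measurable_EFinP; exact: measurable_funM.
  - by apply/measurable_EFinP; exact: measurable_funM.
  - apply: aeW => x Dx; apply: cvg_EFin; first exact: nearW.
    by apply: cvgMl; exact: cG.
  - by apply: integrable_abse; exact: integrableZl.
  - apply: aeW => x n Dx; rewrite /= lee_fin !normrM ler_wpM2r//.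
    by rewrite (le_trans (bG n x Dx))// ler_norm.
  - by [].
split => //; first by exists M.
have l1 := lim m1 w1; have l2 := lim m2 w2.
rewrite -(cvg_lim _ l1)// -(cvg_lim _ l2)//.
by congr (limn _); apply/funext => n; have [] := hG n.
Qed.

End eq_weighted_integral.

(** * Extending equality of Laplace transforms from an interval *)

(** With [z = h x < 0] this reads [z <= e^z - 1 <= z + z^2]. The upper bound follows from
    [e^z (1 - z) <= 1] and [(1 + z + z^2) (1 - z) = 1 - z^3 >= 1]. *)
Lemma expR_slope_bounds (R : realType) (h x : R) : 0 < h -> x < 0 ->
  x <= h^-1 * (expR (h * x) - 1) <= x + h * x ^+ 2.
Proof.
move=> h0 x0; rewrite ler_pdivlMl// ler_pdivrMl//; apply/andP; split.
  by rewrite lerBrDl; exact: expR_ge1Dx.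
pose z := h * x.
have z0 : z < 0 by rewrite /z pmulr_rlt0.
have -> : h * (x + h * x ^+ 2) = z + z ^+ 2 by rewrite /z; ring.
rewrite -/z lerBlDr.
have e1 : expR z * (1 - z) <= 1.
  rewrite -ler_pdivlMl ?expR_gt0// mulr1 -expRN; exact: expR_ge1Dx.
have z1 : 0 < 1 - z by rewrite subr_gt0 (lt_trans z0).
rewrite -(ler_pM2r z1) (le_trans e1)// -subr_ge0.
have -> : (z + z ^+ 2 + 1) * (1 - z) - 1 = (- z) ^+ 3 by ring.
by rewrite exprn_ge0// oppr_ge0 ltW.
Qed.

(** A single Taylor term of [e^(s |x|)] is below the whole exponential. The bound is uniform in [x]
    and dominates the difference quotients used next. *)
Lemma powM_expR_le (R : realType) (s x : R) k : 0 < s -> x < 0 ->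
  `|x| ^+ k.+1 * expR (s * x) <= (k.+1)`!%:R / s ^+ k.+1.
Proof.
move=> s0 x0; rewrite ltr0_norm//.
have sy : 0 <= s * - x by rewrite mulr_ge0 ?ltW// oppr_gt0.
have := expR_ge1Dxn k sy; rewrite mulrN expRN => h.
have f0 : 0 < (k.+1)`!%:R :> R by rewrite ltr0n fact_gt0.
have {}h : (- (s * x)) ^+ k.+1 / (k.+1)`!%:R <= (expR (s * x))^-1.
  by apply: le_trans h; rewrite lerDr.
move: h; rewrite -[leRHS]div1r ler_pdivlMr ?expR_gt0// mulrAC ler_pdivrMr// mul1r.
rewrite ler_pdivlMr ?exprn_gt0//; apply: le_trans.
by rewrite -mulrN exprMn le_eqVlt; apply/orP; left; apply/eqP; ring.
Qed.

Section laplace_neg_unique.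
Context {R : realType} (m1 m2 : {measure set R -> \bar R}) (w : R -> R).

Local Notation neg := (`]-oo, (0 : R)[%classic : set R).
Local Notation good := (eq_weighted_integral m1 m2 neg w).

Hypothesis w1 : m1.-integrable neg (EFin \o w).
Hypothesis w2 : m2.-integrable neg (EFin \o w).

Let mneg : measurable neg. Proof. by []. Qed.

Let negE (x : R) : neg x -> x < 0.
Proof. by rewrite /= in_itv. Qed.

(** Differentiation in [s]: [x^(k+1) e^(s x)] is the bounded pointwise limit of difference quotients
    of [x^k e^(s x)]. *)
Lemma eq_weighted_powM_expR (b : R) :
  (forall s : R, 0 < s < b -> good (fun x => expR (s * x))) ->
  forall k (s : R), 0 < s < b -> good (fun x => x ^+ k * expR (s * x)).
Proof.
move=> hb; elim=> [|k ih] s s0b.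
  by apply: eq_weighted_integral_ext (hb s s0b) => x _; rewrite expr0 mul1r.
have /andP[s0 sb] := s0b.
(* As [harmonic n] is at most [1], the shifted exponent [s + h n] stays below [b]. *)
pose h (n : nat) : R := (b - s) / 2 * harmonic n.
have h0 n : 0 < h n by rewrite mulr_gt0 ?divr_gt0 ?subr_gt0 ?invr_gt0.
have hle n : s + h n < b.
  have : h n <= (b - s) / 2.
    apply: ler_piMr; first by rewrite divr_ge0// subr_ge0 ltW.
    by rewrite /harmonic /= invf_le1// ler1n.
  by move: sb; lra.
pose G n (x : R) : R := (h n)^-1 * (x ^+ k * expR ((s + h n) * x) - x ^+ k * expR (s * x)).
have GE n x : G n x = x ^+ k * expR (s * x) * ((h n)^-1 * (expR (h n * x) - 1)).
  by rewrite /G mulrDl expRD; ring.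
apply: (eq_weighted_integral_cvg mneg w1 w2 (G := G)
  (M := (k.+1)`!%:R / s ^+ k.+1)).
- move=> n; apply: eq_weighted_integralZ => //.
  apply: eq_weighted_integralB => //; apply: ih => //.
  by rewrite hle addr_gt0.
- move=> n x /negE x0; rewrite GE; apply: le_trans (powM_expR_le k s0 x0).
  rewrite !normrM normrX (ger0_norm (expR_ge0 _)) exprSr [leRHS]mulrAC.
  rewrite ler_wpM2l ?mulr_ge0 ?exprn_ge0 ?expR_ge0//.
  have /andP[l _] := expR_slope_bounds (h0 n) x0.
  rewrite -normrM ler0_norm ?ltr0_norm// ?lerN2//.
  by rewrite pmulr_rle0 ?invr_gt0// subr_le0 expR_le1 nmulr_lle0 ?ltW.
- move=> x /negE x0.
  under eq_fun do rewrite GE.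
  rewrite exprSr -mulrA (mulrC x) mulrA.
  apply: cvgMr.
  apply: (@squeeze_cvgr _ _ _ _ (cst x) (fun n => x + h n * x ^+ 2)).
  + by apply: nearW => n; exact: expR_slope_bounds.
  + exact: cvg_cst.
  + rewrite -[X in _ --> X](addr0 x); apply: cvgD; first exact: cvg_cst.
    rewrite -(mul0r (x ^+ 2)); apply: cvgMl.
    by rewrite -(mulr0 ((b - s) / 2)); apply: cvgMr; exact: cvg_harmonic.
Qed.

Lemma series_exp_coeff_le (z : R) n : `|series (exp_coeff z) n| <= expR `|z|.
Proof.
apply: (@le_trans _ _ (series (exp_coeff `|z|) n)).
  rewrite /series /= (le_trans (ler_norm_sum _ _ _))// ler_sum// => i _.
  by rewrite /exp_coeff /= normrM normrX normfV normr_nat.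
apply: nondecreasing_cvgn_le; last exact: is_cvg_series_exp_coeff.
apply: nondecreasing_series => i _ _.
exact: exp_coeff_ge0.
Qed.

(** Write [s = 2 u] with [u < b] and expand one factor of [e^(u x) e^(u x)] in its Taylor series.
    The partial sums times the other factor are at most [e^(|u x|) e^(u x) = 1], because [x < 0]. *)
Lemma eq_weighted_expR_double (b : R) :
  (forall s : R, 0 < s < b -> good (fun x => expR (s * x))) ->
  forall s : R, 0 < s < 2 * b -> good (fun x => expR (s * x)).
Proof.
move=> hb s /andP[s0 sb]; pose u : R := s / 2.
have u0 : 0 < u by rewrite divr_gt0.
have ub : u < b by rewrite ltr_pdivrMr// mulrC.
have sE : s = u + u by rewrite /u -splitr.
clearbody u.
pose G n (x : R) : R := \sum_(0 <= i < n) (u ^+ i / i`!%:R) * (x ^+ i * expR (u * x)).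
have GE n x : G n x = series (exp_coeff (u * x)) n * expR (u * x).
  rewrite /G /series /= mulr_suml; apply: eq_bigr => i _.
  by rewrite /exp_coeff /= exprMn -!mulrA (mulrCA _ (x ^+ i)).
apply: (eq_weighted_integral_cvg mneg w1 w2 (G := G) (M := 1)).
- move=> n; apply: eq_weighted_integral_sum => // i.
  apply: eq_weighted_integralZ => //.
  by apply: eq_weighted_powM_expR hb _ _ _; rewrite u0.
- move=> n x /negE x0; rewrite GE normrM (ger0_norm (expR_ge0 _)).
  rewrite (@le_trans _ _ (expR `|u * x| * expR (u * x)))//.
    by rewrite ler_wpM2r ?expR_ge0// series_exp_coeff_le.
  by rewrite ltr0_norm ?pmulr_rlt0// -expRD addNr expR0.
- move=> x _; under eq_fun do rewrite GE.
  rewrite sE mulrDl expRD; apply: cvgMl.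
  exact: is_cvg_series_exp_coeff.
Qed.

Lemma eq_weighted_expR (b : R) : 0 < b ->
  (forall s : R, 0 < s < b -> good (fun x => expR (s * x))) ->
  forall s : R, 0 < s -> good (fun x => expR (s * x)).
Proof.
move=> b0 hb.
have iterd n : forall s : R, 0 < s < 2 ^+ n * b -> good (fun x => expR (s * x)).
  elim: n => [|n ih]; first by rewrite expr0 mul1r.
  by rewrite exprS -mulrA; exact: eq_weighted_expR_double.
move=> s s0; have [k hk] := @expr_unbounded R 2 (s / b) (ltr1n _ 2).
apply: (iterd k); rewrite s0 /= -ltr_pdivrMr//.
exact: hk.
Qed.

(** Each further factor [1 - e^(L x)] is a difference of the previous functions at [s] and [s + L],
    hence the induction over all [s] at once. *)
Lemma eq_weighted_expR_poly (L : R) m : 0 <= L ->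
  (forall s : R, 0 < s -> good (fun x => expR (s * x))) ->
  forall s : R, 0 < s -> good (fun x => (1 - expR (L * x)) ^+ m * expR (s * x)).
Proof.
move=> L0 h; elim: m => [|m ih] s s0.
  by apply: eq_weighted_integral_ext (h s s0) => x _; rewrite expr0 mul1r.
have sL : 0 < s + L by rewrite ltr_pwDl.
have := eq_weighted_integralB mneg w1 w2 (ih s s0) (ih (s + L) sL).
apply: eq_weighted_integral_ext => // x _.
by rewrite mulrDl expRD exprS; ring.
Qed.

End laplace_neg_unique.

(** * Approximating the indicator of a half-line by exponentials *)

Lemma bernoulli_1B (R : realType) (v : R) m : 0 <= v <= 1 ->
  1 - m%:R * v <= (1 - v) ^+ m.
Proof.
move=> /andP[v0 v1]; elim: m => [|m ih]; first by rewrite mul0r subr0 expr0.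
rewrite exprS -natr1.
have mv : 0 <= m%:R * v ^+ 2 by rewrite mulr_ge0// sqr_ge0.
apply: (@le_trans _ _ ((1 - v) * (1 - m%:R * v))).
  rewrite -subr_ge0 [leRHS](_ : _ = m%:R * v ^+ 2)//; ring.
by rewrite ler_wpM2l// subr_ge0.
Qed.

(* The exponent is of order [n e^(n a)]: against [e^(n x)] it diverges when
   [x >= - a], including at the possible atom [x = - a], and vanishes when
   [x < - a]. *)
Lemma cvg_double_exp (R : realType) (a x : R) : 0 <= a -> x < 0 ->
  (1 - expR (n%:R * x)) ^+ (Num.truncn (n%:R * expR (n%:R * a) : R)).+1
    @[n --> \oo] --> (\1_(`]-oo, - a[%classic : set R) x : R).
Proof.
move=> a0 x0.
pose V n := n%:R * expR (n%:R * a) : R.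
pose m n := (Num.truncn (V n)).+1.
have V0 n : 0 <= V n by rewrite mulr_ge0// expR_ge0.
have Vm n : V n <= (m n)%:R by rewrite ltW//; have /andP[] := truncn_itv (V0 n).
have mV n : (m n)%:R <= V n + 1.
  by rewrite /m -natr1 lerD2r; have /andP[] := truncn_itv (V0 n).
have v0 n : 0 <= expR (n%:R * x) <= 1.
  by rewrite expR_ge0 expR_le1 mulr_ge0_le0// ltW.
have v1 n : 0 <= 1 - expR (n%:R * x) by rewrite subr_ge0; have /andP[] := v0 n.
have [xa|xa] := ltP x (- a).
  rewrite indicE mem_set /= ?in_itv//=.
  pose d := - x - a; have d0 : 0 < d by rewrite /d; lra.
  (* From [e^y >= y^2 / 2] at [y = (n+1) d] and [e^(n d) = e^((n+1) d) / e^d] one gets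
     [(n+1) e^(-n d) <= C / (n+1)]. *)
  pose C := 2 * expR d / d ^+ 2.
  apply: (@squeeze_cvgr _ _ _ _ (fun n => 1 - C * harmonic n) (cst 1)).
  - apply: nearW => n; apply/andP; split; last first.
      by rewrite exprn_ile1//= gerBl; have /andP[] := v0 n.
    apply: le_trans (bernoulli_1B _ (v0 n)); rewrite lerD2l lerN2.
    apply: (@le_trans _ _ (n.+1%:R * expR (- (n%:R * d)))).
      have -> : - (n%:R * d) = n%:R * a + n%:R * x by rewrite /d; ring.
      rewrite expRD mulrA ler_wpM2r ?expR_ge0// (le_trans (mV n))//.
      by rewrite -natr1 mulrDl mul1r lerD2l -[leLHS]expR0 ler_expR mulr_ge0.
    rewrite /harmonic /= expRN ler_pdivrMr ?expR_gt0//.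
    have -> : n%:R * d = n.+1%:R * d - d by rewrite -natr1; ring.
    rewrite expRD expRN.
    have nd0 : 0 <= n.+1%:R * d by rewrite mulr_ge0// ltW.
    have /= := expR_ge1Dxn 1 nd0.
    have ed : 0 < expR d by rewrite expR_gt0.
    set E := expR (n.+1%:R * d) => hE.
    have {}hE : (n.+1%:R * d) ^+ 2 / 2 <= E by apply: le_trans hE; rewrite lerDr.
    have -> : C / n.+1%:R * (E / expR d) = E * 2 / (d ^+ 2 * n.+1%:R).
      by rewrite /C; field; rewrite nat1r pnatr_eq0 /= !gt_eqF.
    rewrite ler_pdivlMr ?mulr_gt0 ?exprn_gt0//.
    by rewrite -ler_pdivrMr//; apply: le_trans hE; rewrite le_eqVlt;
      apply/orP; left; apply/eqP; ring.
  - rewrite -[X in _ --> X](subr0 1); apply: cvgB; first exact: cvg_cst.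
    by rewrite -(mulr0 C); apply: cvgMr; exact: cvg_harmonic.
  - exact: cvg_cst.
rewrite indicE memNset /=; last by rewrite in_itv /=; apply/negP; rewrite -leNgt.
apply: (@squeeze_cvgr _ _ _ _ (cst 0) harmonic).
- apply: nearW => n; apply/andP; split; first by rewrite exprn_ge0.
  apply: (@le_trans _ _ (expR (- n%:R))).
    (* With [v = e^(n x)], [(1 - v)^m <= e^(-m v)], and [m v >= n e^(n (a + x)) >= n] since
       [x >= - a]. *)
    apply: (@le_trans _ _ (expR (- expR (n%:R * x)) ^+ m n)).
      by rewrite lerXn2r ?nnegrE ?expR_ge0// expR_ge1Dx.
    rewrite -expRM_natl ler_expR mulrN lerN2.
    apply: (@le_trans _ _ (V n * expR (n%:R * x))); last first.
      by rewrite ler_wpM2r ?expR_ge0.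
    rewrite /V -mulrA -expRD -mulrDr ler_peMr//.
    rewrite -[leLHS]expR0 ler_expR mulr_ge0//.
    by move: xa; lra.
  rewrite expRN /harmonic /= lef_pV2 ?posrE ?expR_gt0// -natr1 addrC.
  exact: expR_ge1Dx.
- exact: cvg_cst.
- exact: cvg_harmonic.
Qed.

(** * Identification of the measure *)

Section uniqueness.
Context {R : realType}.
Local Open Scope ereal_scope.
Implicit Types mu nu : probability R R.

Local Notation neg := (`]-oo, 0%R[%classic : set R).

(** The weight [w = e^(-t0 x)] with [t0 = d / 2] turns the hypothesis at [t0 - s] into equality for
    the bounded test function [e^(s x)], [0 < s < t0]. After the extension to all [s > 0] and the
    passage to the limit, the test function [1_A e^(t0 x)] is reached; its product with [w] is
    [1_A]. *)
Lemma laplace_neg_tail mu nu (d a : R) : (0 < d)%R -> (0 <= a)%R ->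
  (forall t, (0 < t < d)%R ->
    \int[mu]_(x in neg) (expR (- (t * x)))%:E < +oo /\
    \int[mu]_(x in neg) (expR (- (t * x)))%:E =
    \int[nu]_(x in neg) (expR (- (t * x)))%:E) ->
  mu (`]-oo, (- a)%R[%classic : set R) = nu (`]-oo, (- a)%R[%classic : set R).
Proof.
move=> d0 a0 h; have mneg : measurable neg by [].
pose t0 : R := (d / 2)%R.
have t00 : (0 < t0)%R by rewrite divr_gt0.
have t0d : (t0 < d)%R by rewrite /t0; lra.
clearbody t0.
pose w (x : R) : R := expR (- (t0 * x)).
have mexp (m : probability R R) (t : R) :
    \int[m]_(x in neg) (expR (- (t * x)))%:E < +oo ->
    m.-integrable neg (EFin \o (fun x : R => expR (- (t * x)))).
  move=> hm; apply/integrableP; split.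
    by apply: measurable_funTS; exact: measurable_expRM.
  by under eq_integral do rewrite /= ger0_norm ?expR_ge0//.
have [|h1 h2] := h t0; first by rewrite t00.
have w1 : mu.-integrable neg (EFin \o w) by exact: mexp.
have w2 : nu.-integrable neg (EFin \o w) by apply: mexp; rewrite -h2.
have negE (x : R) : neg x -> (x < 0)%R by rewrite /= in_itv.
have base (s : R) : (0 < s < t0)%R ->
    eq_weighted_integral mu nu neg w (fun x => expR (s * x)).
  move=> /andP[s0 st]; split.
  - have -> : (fun x : R => expR (s * x)) = (fun x => expR (- (- s * x))).
      by apply/funext => x; rewrite mulNr opprK.
    by apply: measurable_funTS; apply/measurable_EFinP; exact: measurable_expRM.
  - exists 1%R => x /negE x0; rewrite ger0_norm ?expR_ge0//.
    by rewrite expR_le1 mulr_ge0_le0// ltW.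
  - have E (m : probability R R) : \int[m]_(x in neg) (expR (s * x) * w x)%:E =
        \int[m]_(x in neg) (expR (- ((t0 - s) * x)))%:E.
      by apply: eq_integral => x _; rewrite /w -expRD; congr (expR _)%:E; ring.
    rewrite !E; apply: (h _ _).2; rewrite subr_gt0 st /=; lra.
have all := eq_weighted_expR w1 w2 t00 base.
pose A := `]-oo, (- a)%R[%classic : set R.
have mA : measurable A by exact: measurable_itv.
have [_ _] : eq_weighted_integral mu nu neg w
    (fun x => \1_A x * expR (t0 * x))%R.
  apply: (eq_weighted_integral_cvg mneg w1 w2 (M := 1%R)
    (G := fun n (x : R) => ((1 - expR (n%:R * x)) ^+
      (Num.truncn (n%:R * expR (n%:R * a) : R)).+1 * expR (t0 * x))%R)).
  - by move=> n; exact: eq_weighted_expR_poly.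
  - move=> n x /negE x0.
    have e1 : (expR (n%:R * x) <= 1)%R.
      by rewrite expR_le1 mulr_ge0_le0// ltW.
    rewrite ger0_norm; last by rewrite mulr_ge0 ?expR_ge0// exprn_ge0// subr_ge0.
    rewrite mulr_ile1 ?expR_ge0 ?exprn_ge0 ?subr_ge0//.
      by rewrite exprn_ile1 ?subr_ge0//= gerBl expR_ge0.
    by rewrite expR_le1 mulr_ge0_le0// ltW.
  - by move=> x /negE x0; apply: cvgMl; exact: cvg_double_exp.
have E (m : probability R R) :
    \int[m]_(x in neg) (\1_A x * expR (t0 * x) * w x)%:E = m A.
  transitivity (\int[m]_(x in neg) (\1_A x)%:E).
    apply: eq_integral => x _; rewrite /w -mulrA -expRD.
    by rewrite subrr expR0 mulr1.
  rewrite integral_indic//; congr (m _); apply/setIidPl => x.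
  by rewrite /A /= !in_itv /= => /lt_le_trans; apply; rewrite oppr_le0.
by rewrite !E.
Qed.

(** The open left half-lines form a generating pi-system that exhausts the line. *)
Lemma eq_probability_lt mu nu :
  (forall b : R, mu (`]-oo, b[%classic : set R) = nu (`]-oo, b[%classic : set R)) ->
  forall A : set R, measurable A -> mu A = nu A.
Proof.
move=> h A mA.
apply: (measure_unique (@RGenInftyO.G R) (fun k => `]-oo, k%:R[%classic)) => //.
- exact: RGenInftyO.measurableE.
- move=> _ _ [x ->] [y ->]; exists (Num.min x y).
  by apply/seteqP; split => z /=; rewrite !in_itv /= lt_min; [move=> [-> ->]|move=> /andP].
- by move=> k; exists k%:R.
- apply/seteqP; split => // x _; exists (Num.bound `|x|) => //=.
  rewrite in_itv /=; apply: le_lt_trans (ler_norm x) _.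
  by rewrite archi_boundP.
- by move=> _ [x ->]; exact: h.
- by move=> k; rewrite -ge0_fin_numE// fin_num_measure.
Qed.

Lemma condE_classC mu : condE mu -> classC mu.
Proof.
move=> hE nu same.
have mneg : measurable neg by [].
have same' := same_pos_restrictions_sym same.
have posE (A : set R) : measurable A -> A `<=` `[0%R, +oo[%classic -> nu A = mu A.
  by move=> mA A0; rewrite -!conv_pow1// same.
have negE : nu neg = mu neg.
  by rewrite -!conv_pow1// (same_pos_conv_pow_neg same).
(* A law without negative mass is treated apart, since the geometric bound for all [n] rests on a
   positive first term; here both laws live on [[0, +oo[], where they agree. *)
have [mu0|mu0] := eqVneq (mu neg) 0.
  move=> A mA.
  have split_mass (m : probability R R) : m neg = 0 -> m A = m (A `\` neg).
    move=> m0; rewrite (measureDI m mA mneg) -[RHS]adde0; congr (_ + _).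
    by apply: subset_measure0 m0 => //; exact: measurableI.
  rewrite !split_mass ?negE// posE//; first exact: measurableD.
  by move=> x [_ /=]; rewrite !in_itv /= andbT => /negP; rewrite -leNgt.
have mupos : 0 < mu neg by rewrite lt0e mu0 measure_ge0.
have [d [d0 hd]] := laplace_neg_eq same' hE mupos.
(* For [b >= 0] the complement lies in [[0, +oo[]; for [b < 0] the Laplace argument applies with
   [a = - b]. *)
apply: eq_probability_lt => b; have [b0|b0] := leP 0%R b.
  have : nu (~` `]-oo, b[%classic) = mu (~` (`]-oo, b[%classic : set R)).
    apply: posE; first exact: measurableC.
    by move=> x /=; rewrite !in_itv /= andbT => /negP; rewrite -leNgt; exact: le_trans.
  have setCD (m : probability R R) : m (`]-oo, b[%classic : set R) =
      1 - m (~` (`]-oo, b[%classic : set R)).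
    by rewrite -[in LHS](setCK `]-oo, b[%classic) probability_setC//; exact: measurableC.
  by move=> e; rewrite !setCD e.
by rewrite -(opprK b) (laplace_neg_tail d0 _ hd)// oppr_ge0 ltW.
Qed.

End uniqueness.

Theorem theorem2p4 (R : realType) (mu : probability R R) :
  ~ (msupport mu `<=` [set` `]-oo, (0:R)[]) ->
  (forall mu1 : probability R R, same_pos_restrictions mu1 mu ->
     (condE mu1 <-> condE mu)) /\
  (condE mu -> classC mu).
Proof.
move=> _; split; last exact: condE_classC.
by move=> mu1; exact: same_pos_condE.
Qed.
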